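(* Let $B=\{\underline{\mathbf{x}}^{\beta_1},\ldots,\underline{\mathbf{x}}^{\beta_r}\}$ and $B'=\{\underline{\mathbf{x}}^{\beta'_1},\ldots,\underline{\mathbf{x}}^{\beta'_r}\}$ be two sets of $r$ monomials in $R_{\delta_1,\ldots,\delta_k}$, each connected to $1$. Let $\Lambda$ be a linear form in $(\langle B'\cdot B^{+}\rangle_{\delta_1,\ldots,\delta_k})^{*}$, and let $\Lambda(\mathbf{h})$ be the linear form on $\langle B'\cdot B^{+}\rangle$ defined on the monomials $\underline{\mathbf{x}}^{\alpha}\in B'\cdot B^{+}$ by $\Lambda(\mathbf{h})(\underline{\mathbf{x}}^{\alpha})=\Lambda(\underline{\mathbf{x}}^{\alpha})$ if $\underline{\mathbf{x}}^{\alpha}\in R_{\delta_1,\ldots,\delta_k}$, and $\Lambda(\mathbf{h})(\underline{\mathbf{x}}^{\alpha})=h_{\alpha}\in\mathbb{K}$ otherwise. Then $\Lambda(\mathbf{h})$ admits an extension $\tilde\Lambda\in R^{*}$ such that $H_{\tilde\Lambda}$ is of rank $r$, with $B$ and $B'$ each a basis of $\mathcal{A}_{\tilde\Lambda}$, if and only if $$\det\big(\mathcal{H}^{B',B}_{\Lambda(\mathbf{h})}\big)\neq 0$$ and $$\mathcal{M}^{B}_{i,l}(\mathbf{h})\circ\mathcal{M}^{B}_{j,q}(\mathbf{h})-\mathcal{M}^{B}_{j,q}(\mathbf{h})\circ\mathcal{M}^{B}_{i,l}(\mathbf{h})=0\qquad (1\le l,q\le k,\ 1\le i\le n_l,\ 1\le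 j\le n_q).$$ Moreover, such a $\tilde\Lambda$ is unique.
   Context: $\mathbb{K}$ is an algebraically closed field of characteristic $0$. Fix $k$, $n_1,\ldots,n_k$ and $\delta_1,\ldots,\delta_k\in\mathbb{N}$. $R=\mathbb{K}[\underline{\mathbf{x}}_1,\ldots,\underline{\mathbf{x}}_k]$ is the polynomial ring in all the variables $x_{i,l}$, $1\le l\le k$, $1\le i\le n_l$, where $\underline{\mathbf{x}}_l=(x_{1,l},\ldots,x_{n_l,l})$. For $\alpha=(\alpha_1,\ldots,\alpha_k)\in\mathbb{N}^{n_1}\times\cdots\times\mathbb{N}^{n_k}$, $\underline{\mathbf{x}}^{\alpha}=\prod_{l=1}^{k}\prod_{i=1}^{n_l}x_{i,l}^{\alpha_{i,l}}$ and $|\alpha_l|=\sum_i\alpha_{i,l}$. $R_{\delta_1,\ldots,\delta_k}$ is the subspace of $R$ spanned by the monomials $\underline{\mathbf{x}}^{\alpha}$ with $|\alpha_l|\le\delta_l$ for all $l$. $\langle F\rangle$ denotes the $\mathbb{K}$-linear span of $F$, and $E^{*}$ the dual space of a $\mathbb{K}$-vector space $E$. A set $B$ of monomials is connected to $1$ if for every $m\in B$ either $m=1$ or $m=x_{i,l}\,m'$ for some variable $x_{i,l}$ and some $m'\in B$. $B^{+}=B\cup\bigcup_{i,l}x_{i,l}B$ (union over all variables of $R$). $B'\cdot B^{+}$ is the set of products $b'b$ with $b'\in B'$, $b\in B^{+}$, and $\langle B'\cdot B^{+}\rangle_{\delta_1,\ldots,\delta_k}=\langle B'\cdot B^{+}\rangle\cap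 R_{\delta_1,\ldots,\delta_k}$. For $\tilde\Lambda\in R^{*}$ and $p\in R$, $p\star\tilde\Lambda\in R^{*}$ is $q\mapsto\tilde\Lambda(pq)$. The Hankel operator is $H_{\tilde\Lambda}:R\to R^{*}$, $p\mapsto p\star\tilde\Lambda$; its kernel $I_{\tilde\Lambda}$ is an ideal of $R$ and $\mathcal{A}_{\tilde\Lambda}=R/I_{\tilde\Lambda}$. ''$B$ is a basis of $\mathcal{A}_{\tilde\Lambda}$'' means that the classes of the elements of $B$ form a $\mathbb{K}$-basis of $\mathcal{A}_{\tilde\Lambda}$. An extension of $\Lambda(\mathbf{h})$ is an element of $R^{*}$ whose restriction to $\langle B'\cdot B^{+}\rangle$ is $\Lambda(\mathbf{h})$. $\mathcal{H}^{B',B}_{\Lambda(\mathbf{h})}=(\Lambda(\mathbf{h})(b'b))_{b'\in B',\,b\in B}$ and $\mathcal{H}^{B',B}_{x_{i,l}\star\Lambda(\mathbf{h})}=(\Lambda(\mathbf{h})(x_{i,l}\,b'b))_{b'\in B',\,b\in B}$ (rows indexed by $B'$, columns by $B$). When $\mathcal{H}^{B',B}_{\Lambda(\mathbf{h})}$ is invertible, $\mathcal{M}^{B}_{i,l}(\mathbf{h}):=(\mathcal{H}^{B',B}_{\Lambda(\mathbf{h})})^{-1}\,\mathcal{H}^{B',B}_{x_{i,l}\star\Lambda(\mathbf{h})}$, viewed as a linear operator on $\langle B\rangle$ in the basis $B$. *)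

(* Defs.v *)
From HB Require Import structures.
From mathcomp Require Import all_boot all_order all_algebra.
From mathcomp Require Import ssrcomplements.
From mathcomp Require Export mpoly.

Set Implicit Arguments.
Unset Strict Implicit.
Unset Printing Implicit Defensive.

Import GRing.Theory.
Local Open Scope ring_scope.

(* A linear subspace of V as a type, so that {scalar subspace W} is its dual. *)
Section Subspace.
Variables (K : fieldType) (V : lmodType K) (W : submodClosed V).

Record subspace := Subspace { subspace_val :> V; _ : subspace_val \in W }.

HB.instance Definition _ := [isSub for subspace_val].
HB.instance Definition _ := [Choice of subspace by <:].
HB.instance Definition _ := [SubChoice_isSubLmodule of subspace by <:].

End Subspace.

Section LinearAlgebra.
Variables (K : fieldType) (U V : lmodType K).

(* The image of f : V -> U^* has dimension r: the r forms f (v i) are a basis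
   of it.  Forms are compared pointwise. *)
Definition has_rank (f : V -> {scalar U}) (r : nat) : Prop :=
  exists v : 'I_r -> V,
    (forall c : 'I_r -> K,
       (forall q, \sum_i c i * f (v i) q = 0) -> forall i, c i = 0) /\
    (forall w, exists c : 'I_r -> K,
       forall q, f w q = \sum_i c i * f (v i) q).

(* The classes of b_1, ..., b_r form a basis of the quotient V / I: a linear
   relation between classes is a linear combination lying in I, and two
   vectors have the same class when their difference is in I. *)
Definition quotient_basis (I : V -> Prop) (r : nat) (b : 'I_r -> V) : Prop :=
  (forall c : 'I_r -> K, I (\sum_i c i *: b i) -> forall i, c i = 0) /\
  (forall v, exists c : 'I_r -> K, I (v - \sum_i c i *: b i)).

End LinearAlgebra.

(* Span of a set S of monomials: p is the linear combination of the elements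
   of S with its own coefficients.  See mspanP. *)
Section MonomialSpan.
Variables (K : fieldType) (N : nat).
Implicit Types (S T : {pred 'X_{1..N}}) (p : {mpoly K[N]}) (m : 'X_{1..N}).

Definition mspan S : {pred {mpoly K[N]}} :=
  fun p => p == \sum_(m <- msupp p | m \in S) p@_m *: 'X_[m].

Lemma mspan_supp S p : p \in mspan S <-> {subset msupp p <= S}.
Proof.
rewrite [p \in _]/(_ == _); split=> [/eqP pE m m_p|sub].
  apply: contraLR m_p => mS; rewrite mcoeff_msupp negbK pE raddf_sum /=.
  apply/eqP/big1 => m' m'S; rewrite mcoeffZ mcoeffX.
  by case: eqP m'S mS => [->->|]; rewrite ?mulr0.
apply/eqP; rewrite {1}[p]mpolyE big_seq [in RHS]big_seq_cond.
by congr (\val _); apply: eq_bigl => m; case: (boolP (m \in msupp p)) => // /sub ->.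
Qed.

Lemma mspanP S p :
  p \in mspan S <->
  exists (s : seq 'X_{1..N}) (c : 'X_{1..N} -> K),
    {subset s <= S} /\ p = \sum_(m <- s) c m *: 'X_[m].
Proof.
split=> [/mspan_supp sub|[s [c [sub ->]]]].
  by exists (msupp p), (fun m => p@_m); rewrite -mpolyE.
apply/mspan_supp => m; rewrite mcoeff_msupp; apply: contraR => mS.
rewrite raddf_sum /= big_seq big1 // => m' /sub m'S; rewrite mcoeffZ mcoeffX.
by case: eqP m'S mS => [->->|]; rewrite ?mulr0.
Qed.

Lemma mspanX S m : m \in S -> 'X_[m] \in mspan S.
Proof.
by move=> mS; apply/mspan_supp => m'; rewrite msuppX inE => /eqP->.
Qed.

Lemma mspan_submod_closed S : submod_closed (mspan S).
Proof.
split=> [|c p q /mspan_supp Sp /mspan_supp Sq]; apply/mspan_supp => m.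
  by rewrite msupp0.
by move=> /msuppD_le; rewrite mem_cat => /orP[/msuppZ_le /Sp|/Sq].
Qed.

HB.instance Definition _ S :=
  GRing.isSubmodClosed.Build K {mpoly K[N]} (mspan S) (mspan_submod_closed S).

Definition mspanI S T : {pred {mpoly K[N]}} :=
  [predI mspan S & mspan T].

Lemma mspanI_submod_closed S T : submod_closed (mspanI S T).
Proof.
split=> [|c p q /andP[Sp Tp] /andP[Sq Tq]]; apply/andP; split.
- exact: (mspan_submod_closed S).1.
- exact: (mspan_submod_closed T).1.
- exact: (mspan_submod_closed S).2.
- exact: (mspan_submod_closed T).2.
Qed.

HB.instance Definition _ S T :=
  GRing.isSubmodClosed.Build K {mpoly K[N]} (mspanI S T)
    (mspanI_submod_closed S T).

(* The linear form on the span of S that takes the value f m at m in S. *)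
Definition mform S (f : 'X_{1..N} -> K) (w : subspace (mspan S)) : K :=
  \sum_(m <- msupp (val w)) (val w)@_m * f m.

Lemma mformwE S f (w : subspace (mspan S)) (d : nat) : (msize (val w) <= d)%N ->
  mform f w = \sum_(m : 'X_{1..N < d}) (val w)@_m * f m.
Proof.
move=> le_d; rewrite /mform (big_mksub 'X_{1..N < d}) //=; first last.
- by move=> m m_w; apply: leq_trans le_d; apply: msize_mdeg_lt.
- exact: msupp_uniq.
rewrite big_rmcond //= => m /memN_msupp_eq0 ->; exact: mul0r.
Qed.

Lemma mform_is_linear S f : scalar (@mform S f).
Proof.
move=> c u v; pose d := maxn (msize (val (c *: u + v)))
  (maxn (msize (val u)) (msize (val v))).
rewrite !(@mformwE _ _ _ d) ?leq_max ?leqnn ?orbT // mulr_sumr -big_split /=.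
by apply: eq_bigr => m _; rewrite mcoeffD mcoeffZ mulrDl mulrA.
Qed.

HB.instance Definition _ S f :=
  GRing.isLinear.Build K (subspace (mspan S)) K _ (@mform S f)
    (@mform_is_linear S f).

End MonomialSpan.

(* The ring R in k groups of n_1, ..., n_k variables.  The variable x_{i,l}
   is the one of index tagnat.Rank l i. *)
Section Multigraded.
Variables (K : fieldType) (k : nat) (n delta : 'I_k -> nat).

Local Notation N := (\sum_(l < k) n l)%N.
Local Notation R := {mpoly K[N]}.
Local Notation mon := 'X_{1..N}.

Definition xvar (l : 'I_k) (i : 'I_(n l)) : mon := U_(tagnat.Rank l i)%MM.

Definition block_deg (m : mon) (l : 'I_k) : nat :=
  (\sum_(i < n l) m (tagnat.Rank l i))%N.

Definition Mdelta : {pred mon} :=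
  [pred m : mon | [forall l, block_deg m l <= delta l]%N].

Definition Rdelta : {pred R} := mspan Mdelta.

Definition connected_to_1 (B : seq mon) : Prop :=
  forall m, m \in B -> m = 0%MM \/
    exists (l : 'I_k) (i : 'I_(n l)) (m' : mon),
      m' \in B /\ m = (xvar i + m')%MM.

Definition Bplus (B : seq mon) : seq mon :=
  B ++ [seq (xvar (tagged v) + b)%MM | v <- enum {: {l : 'I_k & 'I_(n l)}},
                                       b <- B].

Definition mprod (B' B : seq mon) : seq mon :=
  [seq (b' + b)%MM | b' <- B', b <- B].

Section TwoSets.
Variables (r : nat) (B' B : r.-tuple mon).

Local Notation BBp := (mem (mprod B' (Bplus B))).
Definition spanBBp : submodClosed R := mspan BBp.
Definition spanBBp_delta : submodClosed R := mspanI BBp Mdelta.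

Lemma mprodBBp b' b : b' \in B' -> b \in B -> (b' + b)%MM \in BBp.
Proof.
by move=> b'B bB; apply/allpairsP; exists (b', b); rewrite mem_cat bB.
Qed.

Lemma mprodBxB b' b l (i : 'I_(n l)) :
  b' \in B' -> b \in B -> (b' + (xvar i + b))%MM \in BBp.
Proof.
move=> b'B bB; apply/allpairsP; exists (b', (xvar i + b)%MM); split=> //=.
rewrite mem_cat; apply/orP; right; apply/allpairsP.
by exists (Tagged (fun l => 'I_(n l)) i, b); rewrite mem_enum.
Qed.

(* The elements x^(b'_i) x^(b_j) and x_{a,l} x^(b'_i) x^(b_j) of <B'.B^+>. *)
Definition BB_elt (i j : 'I_r) : subspace spanBBp :=
  Subspace (mspanX K (mprodBBp (mem_tnth i B') (mem_tnth j B))).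

Definition BxB_elt l (a : 'I_(n l)) (i j : 'I_r) : subspace spanBBp :=
  Subspace (mspanX K (mprodBxB a (mem_tnth i B') (mem_tnth j B))).

(* Lambda(h): on a monomial of B'.B^+, insub succeeds exactly when the
   monomial lies in R_delta.  See Lambda_h_in and Lambda_h_out. *)
Definition Lambda_h_mon (Lambda : {scalar subspace spanBBp_delta}) (h : mon -> K)
    (m : mon) : K :=
  if insub 'X_[m] : option (subspace spanBBp_delta) is Some w then Lambda w else h m.

Definition Lambda_h (Lambda : {scalar subspace spanBBp_delta}) (h : mon -> K) :
    {scalar subspace spanBBp} :=
  @mform K N BBp (Lambda_h_mon Lambda h).

Lemma Lambda_h_in Lambda h m (w : subspace spanBBp) (v : subspace spanBBp_delta) :
  val w = 'X_[m] -> val v = 'X_[m] -> Lambda_h Lambda h w = Lambda v.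
Proof.
move=> wE vE; rewrite /= /mform wE msuppX big_seq1 mcoeffX eqxx mul1r.
by rewrite /Lambda_h_mon -vE valK.
Qed.

Lemma Lambda_h_out Lambda h m (w : subspace spanBBp) :
  val w = 'X_[m] -> 'X_[m] \notin Rdelta -> Lambda_h Lambda h w = h m.
Proof.
move=> wE mR; rewrite /= /mform wE msuppX big_seq1 mcoeffX eqxx mul1r.
by rewrite /Lambda_h_mon insubN // inE negb_and mR orbT.
Qed.

Definition hankel_mx (L : {scalar subspace spanBBp}) : 'M[K]_r :=
  \matrix_(i, j) L (BB_elt i j).

Definition shifted_hankel_mx (L : {scalar subspace spanBBp}) l (a : 'I_(n l)) :
    'M[K]_r :=
  \matrix_(i, j) L (BxB_elt a i j).

(* Matrix in the basis B of the operator M_{a,l}, acting on column vectors, so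
   that composition of operators is *m. *)
Definition mult_mx (L : {scalar subspace spanBBp}) l (a : 'I_(n l)) : 'M[K]_r :=
  invmx (hankel_mx L) *m shifted_hankel_mx L a.

Definition is_extension (L : {scalar subspace spanBBp}) (Lt : {scalar R}) : Prop :=
  forall w : subspace spanBBp, Lt (val w) = L w.

End TwoSets.

Section Star.
Variable (Lt : {scalar R}).

Definition star (p q : R) : K := Lt (p * q).

Lemma star_is_linear p : scalar (star p).
Proof. by move=> c u v; rewrite /star mulrDr -scalerAr linearP. Qed.

HB.instance Definition _ p :=
  GRing.isLinear.Build K R K _ (star p) (star_is_linear p).

Definition hankel_op (p : R) : {scalar R} := star p.

Definition hankel_ker (p : R) : Prop := forall q, hankel_op p q = 0.

End Star.

Definition basis_of_A (Lt : {scalar R}) r (B : r.-tuple mon) : Prop :=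
  quotient_basis (hankel_ker Lt) (fun i => 'X_[tnth B i]).

Definition good_extension r (B' B : r.-tuple mon)
    (L : {scalar subspace (spanBBp B' B)}) (Lt : {scalar R}) : Prop :=
  [/\ is_extension L Lt, has_rank (hankel_op Lt) r,
      basis_of_A Lt B & basis_of_A Lt B'].

End Multigraded.

Arguments Rdelta K {k n} delta.
Arguments spanBBp K {k n r} B' B.
Arguments spanBBp_delta K {k n} delta {r} B' B.

(* Main.v *)
From HB Require Import structures.
Require Import Defs.
From mathcomp Require Import all_boot all_order all_algebra.

Set Implicit Arguments.
Unset Strict Implicit.
Unset Printing Implicit Defensive.

Import GRing.Theory.
Local Open Scope ring_scope.

(** Write H for the Hankel matrix of Lambda(h), S_u for the one shifted by the
    variable x_u, and M_u = H^-1 S_u.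

    If an extension with the two bases exists, H is the matrix of the
    nondegenerate pairing (p, q) |-> Lt (p q) on A = R / I between the bases B'
    and B, hence invertible; H M_u = S_u then says that M_u is the matrix in B
    of multiplication by x_u in A ([flat_mult_monomial]), and multiplications
    commute.  This also gives uniqueness: starting from 1, an element of B
    (or of I, when B is empty), the matrices M_u compute the coordinates in B
    of every monomial modulo I, and Lt is prescribed on B because 1 lies in B'
    ([flat_extension_unique]).

    Conversely, let r > 0, H be invertible and the M_u commute.  Then
    p |-> p(M) is a ring morphism and one sets Lt p = e_1^T H p(M) e_1, the
    indices 1 being the positions of the monomial 1 in B' and in B
    ([mult_form]).  Connectedness does the rest.  If
    b = x_u c with b, c in B, column c of S_u is column b of H, so
    M_u e_c = e_b; by induction along B, b(M) e_1 = e_b ([mxeval_col]).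
    If b' = x_u c' with b', c' in B', row c' of S_u is row b' of H, so
    e_c'^T H M_u = e_b'^T H; by induction along B', e_1^T H b'(M) = e_b'^T H
    ([hankel_row]).  Hence Lt (b' p b) = e_b'^T H p(M) e_b for every p, where
    p = 1 and p = x_u show that Lt extends Lambda(h).  As H is invertible, p is
    in the kernel of the Hankel operator iff p(M) e_1 = 0 iff
    e_1^T H p(M) = 0, and p |-> p(M) e_1 and p |-> e_1^T H p(M) H^-1 are the
    coordinate maps that make B and B' bases of A.

    The matrices M_u treat the variables of all groups alike, so the argument
    is carried out for N variables indexed by one ordinal. *)

(** * Matrix evaluation of polynomials *)

Section CommutingEvaluation.
Variables (K : fieldType) (N r : nat) (M : 'I_N -> 'M[K]_r.+1).
Hypothesis comM : forall u v, M u * M v = M v * M u.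

(** [commr_mmap1_M] asks the values to be central; matrices that commute with
    one another are enough. *)
Lemma mmap1D_comm m1 m2 :
  mmap1 M (m1 + m2)%MM = mmap1 M m1 * mmap1 M m2.
Proof.
have comP (I : seq 'I_N) (e : 'I_N -> nat) u k :
    GRing.comm (M u ^+ k) (\prod_(i <- I) M i ^+ e i).
  apply: commr_prod => i _; apply: commrX; apply/commr_sym/commrX.
  exact: comM.
rewrite /mmap1; elim: (index_enum _) => [|u I IH].
  by rewrite !big_nil mulr1.
rewrite !big_cons IH mnmDE exprD !mulrA; congr (_ * _).
by rewrite -!mulrA; congr (_ * _); exact: comP.
Qed.

Definition mxeval (p : {mpoly K[N]}) : 'M[K]_r.+1 := mmap (@scalar_mx K r.+1) M p.

Lemma mxevalX m : mxeval 'X_[m] = mmap1 M m.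
Proof. exact: mmapX. Qed.

Lemma mxeval_is_linear : linear mxeval.
Proof.
move=> c p q; rewrite /mxeval mmapD mmapZ; congr (_ + _).
exact: mul_scalar_mx.
Qed.

HB.instance Definition _ :=
  GRing.isLinear.Build K {mpoly K[N]} 'M[K]_r.+1 _ mxeval mxeval_is_linear.

Lemma mxevalM p q : mxeval (p * q) = mxeval p * mxeval q.
Proof.
rewrite (mpolyE p) (mpolyE q) mulr_suml !linear_sum mulr_suml /=.
apply: eq_bigr => m _; rewrite mulr_sumr !linear_sum mulr_sumr /=.
apply: eq_bigr => m' _; rewrite -scalerAl -scalerAr -mpolyXD !linearZ /=.
by rewrite !mxevalX mmap1D_comm -scalerAl -scalerAr.
Qed.

End CommutingEvaluation.

(** * The annihilator of a linear form *)

Section Annihilator.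
Variables (K : fieldType) (N : nat) (Lt : {scalar {mpoly K[N]}}).

(** [hankel_ker] for an arbitrary number of variables, with which it is
    convertible. *)
Definition annih (p : {mpoly K[N]}) : Prop := forall q, Lt (p * q) = 0.

Lemma annihD p q : annih p -> annih q -> annih (p + q).
Proof. by move=> Ip Iq s; rewrite mulrDl raddfD /= Ip Iq addr0. Qed.

Lemma annihZ c p : annih p -> annih (c *: p).
Proof. by move=> Ip s; rewrite -scalerAl linearZ /= Ip mulr0. Qed.

Lemma annihB p q : annih p -> annih q -> annih (p - q).
Proof. by move=> Ip Iq; rewrite -scaleN1r; apply/annihD/annihZ. Qed.

Lemma annihM p q : annih q -> annih (p * q).
Proof. by move=> Iq s; rewrite -mulrA mulrCA Iq. Qed.

Lemma annih_eq p q s : annih (p - q) -> Lt (p * s) = Lt (q * s).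
Proof. by move=> /(_ s); rewrite mulrBl raddfB => /subr0_eq. Qed.

End Annihilator.

(** The Hankel operator factors through an injection of A into the dual of R,
    so a basis of A maps to a basis of its image. *)
Lemma has_rank_hankel (K : fieldType) k (n : 'I_k -> nat)
    (Lt : {scalar {mpoly K[(\sum_(l < k) n l)%N]}}) r
    (b : 'I_r -> {mpoly K[(\sum_(l < k) n l)%N]}) :
  quotient_basis (hankel_ker Lt) b -> has_rank (hankel_op Lt) r.
Proof.
move=> [b_free b_span]; exists b.
have sumE (c : 'I_r -> K) q :
    \sum_i c i * hankel_op Lt (b i) q = Lt ((\sum_i c i *: b i) * q).
  rewrite mulr_suml linear_sum; apply: eq_bigr => i _.
  by rewrite -scalerAl linearZ.
split=> [c c0 i|w].
  by apply: b_free => q; rewrite -[RHS](c0 q) sumE.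
have [c Ic] := b_span w; exists c => q; rewrite sumE; exact: annih_eq Ic.
Qed.

Lemma mnm_ind N (P : 'X_{1..N} -> Prop) :
  P 0%MM -> (forall u m, P m -> P (U_(u) + m)%MM) -> forall m, P m.
Proof.
move=> P0 PS m; have [d] := ubnP (mdeg m); elim: d m => // d IH m lt_d.
have [->//|] := eqVneq m 0%MM; rewrite -mdeg_eq0 mdegE sum_nat_eq0.
rewrite negb_forall => /existsP[u]; rewrite implyTb -lep1mP => le_um.
rewrite -(submK le_um) addmC; apply/PS/IH.
by move: lt_d; rewrite -{1}(submK le_um) mdegD mdeg1 addn1.
Qed.

(** * Families of monomials connected to 1 *)

Definition connected_family N r (b : 'I_r -> 'X_{1..N}) : Prop :=
  forall j, b j = 0%MM \/ exists u j', b j = (U_(u) + b j')%MM.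

(** The induction is on the degree: dividing by a variable lowers it. *)
Lemma connected_family_ind N r (b : 'I_r -> 'X_{1..N}) (P : 'I_r -> Prop) :
  connected_family b ->
  (forall j, b j = 0%MM -> P j) ->
  (forall u j j', b j = (U_(u) + b j')%MM -> P j' -> P j) ->
  forall j, P j.
Proof.
move=> cb P0 PS j; have [d] := ubnP (mdeg (b j)).
elim: d j => // d IH j lt_d; case: (cb j) => [/P0 //|[u [j' bj]]].
by apply: (PS u j j' bj); apply: IH; move: lt_d; rewrite bj mdegD mdeg1.
Qed.

Lemma connected_family_unit N r (b : 'I_r -> 'X_{1..N}) :
  connected_family b -> 'I_r -> exists j, b j = 0%MM.
Proof. by move=> cb; apply: connected_family_ind => // j; exists j. Qed.

(** * Hankel matrices and multiplication operators *)

Section Flat.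
Variables (K : fieldType) (N r : nat) (b' b : 'I_r -> 'X_{1..N}).
Variable (L : 'X_{1..N} -> K).

Definition hankel_mat : 'M[K]_r := \matrix_(i, j) L (b' i + b j)%MM.

Definition shifted_mat (u : 'I_N) : 'M[K]_r :=
  \matrix_(i, j) L (b' i + (U_(u) + b j))%MM.

Definition mult_mat (u : 'I_N) : 'M[K]_r := invmx hankel_mat *m shifted_mat u.

(** [good_extension] with the values on B'.B^+ prescribed monomial by monomial;
    the rank of the Hankel operator is then given by [has_rank_hankel]. *)
Record flat_extension (Lt : {scalar {mpoly K[N]}}) : Prop := FlatExtension {
  flat_hankel : forall i j, Lt 'X_[b' i + b j] = L (b' i + b j)%MM;
  flat_shifted : forall u i j,
    Lt 'X_[b' i + (U_(u) + b j)] = L (b' i + (U_(u) + b j))%MM;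
  flat_basis : quotient_basis (annih Lt) (fun j => 'X_[b j]);
  flat_basis' : quotient_basis (annih Lt) (fun i => 'X_[b' i]) }.

Definition comb (c : 'cV[K]_r) : {mpoly K[N]} := \sum_j c j 0 *: 'X_[b j].

Lemma comb_is_linear : linear comb.
Proof.
move=> a c d; rewrite /comb scaler_sumr -big_split /=.
by apply: eq_bigr => j _; rewrite !mxE scalerDl scalerA.
Qed.

HB.instance Definition _ :=
  GRing.isLinear.Build K 'cV[K]_r {mpoly K[N]} _ comb comb_is_linear.

Lemma comb_delta j : comb (delta_mx j 0) = 'X_[b j].
Proof.
rewrite /comb (bigD1 j) //= big1 ?addr0 => [|i /negbTE ij].
  by rewrite mxE !eqxx scale1r.
by rewrite mxE ij scale0r.
Qed.

Lemma comb_mulmx (A : 'M[K]_r) c :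
  comb (A *m c) = \sum_j c j 0 *: comb (col j A).
Proof.
have -> : A *m c = \sum_j c j 0 *: col j A.
  apply/colP => i; rewrite mxE summxE; apply: eq_bigr => j _.
  by rewrite !mxE mulrC.
by rewrite linear_sum; apply: eq_bigr => j _; rewrite linearZ.
Qed.

Section Necessity.
Variable (Lt : {scalar {mpoly K[N]}}).
Hypothesis flatLt : flat_extension Lt.

Lemma flat_hankel_comb i c : Lt ('X_[b' i] * comb c) = (hankel_mat *m c) i 0.
Proof.
rewrite /comb mulr_sumr linear_sum mxE; apply: eq_bigr => j _.
by rewrite -scalerAr linearZ -mpolyXD (flat_hankel flatLt) mxE mulrC.
Qed.

(** B' spans the quotient, so pairing with B' detects membership in the
    annihilator. *)
Lemma flat_annih_test p : (forall i, Lt ('X_[b' i] * p) = 0) -> annih Lt p.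
Proof.
move=> p0 q; have [c Ic] := (flat_basis' flatLt).2 q.
rewrite mulrC (annih_eq _ Ic) mulr_suml linear_sum big1 // => i _.
by rewrite -scalerAl linearZ p0 /= mulr0.
Qed.

Lemma flat_free c : annih Lt (comb c) -> c = 0.
Proof.
move=> Ic; apply/colP => j; rewrite [RHS]mxE.
exact: ((flat_basis flatLt).1 (fun j => c j 0) Ic).
Qed.

(** If H c = 0, the combination of B with coefficients c pairs to 0 with B',
    hence vanishes in the quotient, where B is free. *)
Lemma flat_hankel_unit : hankel_mat \in unitmx.
Proof.
rewrite -unitmx_tr -row_free_unit; apply: inj_row_free => v vH.
apply: trmx_inj; rewrite trmx0; apply: flat_free.
apply: flat_annih_test => i; rewrite flat_hankel_comb.
by rewrite -[hankel_mat]trmxK -trmx_mul vH !mxE.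
Qed.

(** M_u is the matrix of multiplication by x_u in the quotient: paired with
    B', both sides give column j of S_u = H M_u. *)
Lemma flat_mult_monomial u j :
  annih Lt ('X_[U_(u)] * 'X_[b j] - comb (col j (mult_mat u))).
Proof.
apply: flat_annih_test => i; rewrite mulrBr raddfB /= flat_hankel_comb.
rewrite -!mpolyXD (flat_shifted flatLt) /mult_mat colE -mulmxA.
by rewrite mulKVmx ?flat_hankel_unit // -colE !mxE subrr.
Qed.

(** By linearity from the monomials of B, as the annihilator is an ideal. *)
Lemma flat_mult p u c : annih Lt (p - comb c) ->
  annih Lt ('X_[U_(u)] * p - comb (mult_mat u *m c)).
Proof.
move=> Ic; rewrite -(subrK ('X_[U_(u)] * comb c) ('X_[U_(u)] * p)) -addrA.
rewrite -mulrBr; apply: annihD; first exact: annihM.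
rewrite comb_mulmx /comb mulr_sumr -sumrB.
elim/big_rec: _ => [q|j q _ Iq]; first by rewrite mul0r raddf0.
apply: annihD Iq; rewrite -scalerAr -scalerBr.
exact/annihZ/flat_mult_monomial.
Qed.

(** Both products of matrices give the coordinates of x_u x_v b_j, and
    coordinates are unique. *)
Lemma flat_mult_comm u v : mult_mat u *m mult_mat v = mult_mat v *m mult_mat u.
Proof.
have Imul j w w' : annih Lt ('X_[U_(w)] * ('X_[U_(w')] * 'X_[b j])
    - comb (mult_mat w *m (mult_mat w' *m delta_mx j 0))).
  do 2!apply: flat_mult; rewrite comb_delta subrr => q.
  by rewrite mul0r raddf0.
apply/matrixP => i j; apply: subr0_eq.
have : annih Lt (comb ((mult_mat u *m mult_mat v - mult_mat v *m mult_mat u)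
    *m delta_mx j 0)).
  have := annihB (Imul j v u) (Imul j u v).
  rewrite [X in X - _ - _]mulrCA opprB addrC addrA subrK -raddfB /=.
  by rewrite mulmxBl !mulmxA.
by move/flat_free/colP/(_ i); rewrite -colE !mxE.
Qed.

End Necessity.

(** The matrices M_u do not depend on the extension, so every monomial has the
    same coordinates in B modulo both annihilators, and both forms agree
    on B. *)
Lemma flat_extension_unique Lt1 Lt2 :
  connected_family b -> connected_family b' ->
  flat_extension Lt1 -> flat_extension Lt2 -> Lt1 =1 Lt2.
Proof.
move=> cb cb' flat1 flat2.
have eq_comb c : Lt1 (comb c) = Lt2 (comb c).
  rewrite !linear_sum; apply: eq_bigr => j _; rewrite !linearZ /=.
  have [i bi0] := connected_family_unit cb' j.
  have := flat_hankel flat1 i j; rewrite bi0 add0m => ->.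
  by have := flat_hankel flat2 i j; rewrite bi0 add0m => ->.
have [c Ic] : exists c, annih Lt1 (1 - comb c) /\ annih Lt2 (1 - comb c).
  (* 1 is in B unless B is empty; then the annihilators are all of R. *)
  have [j|r0] := pickP 'I_r.
    have [j0 bj0] := connected_family_unit cb j; exists (delta_mx j0 0).
    by rewrite comb_delta bj0 mpolyX0 subrr; split=> q; rewrite mul0r raddf0.
  exists 0; split; apply: flat_annih_test => // i; by have := r0 i.
have reduce m : exists c, annih Lt1 ('X_[m] - comb c) /\ annih Lt2 ('X_[m] - comb c).
  elim/mnm_ind: m => [|u m [d [I1 I2]]]; first by exists c; rewrite mpolyX0.
  by exists (mult_mat u *m d); rewrite mpolyXD; split; apply: flat_mult.
move=> p; rewrite (mpolyE p) !linear_sum; apply: eq_bigr => m _.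
rewrite !linearZ; congr (_ * _).
have [d [I1 I2]] := reduce m.
by have := annih_eq 1 I1; have := annih_eq 1 I2; rewrite !mulr1 => -> ->.
Qed.

End Flat.

(** * Construction of the extension *)

Section Sufficiency.
Variables (K : fieldType) (N r : nat) (b' b : 'I_r.+1 -> 'X_{1..N}).
Variable (L : 'X_{1..N} -> K).

Local Notation H := (hankel_mat b' b L).
Local Notation S := (shifted_mat b' b L).
Local Notation M := (mult_mat b' b L).

Hypotheses (cb : connected_family b) (cb' : connected_family b').
Hypothesis unitH : H \in unitmx.
Hypothesis comM : forall u v, M u *m M v = M v *m M u.

Local Notation ev := (mxeval M).

Variables (i0 j0 : 'I_r.+1).
Hypotheses (bi0 : b' i0 = 0%MM) (bj0 : b j0 = 0%MM).

Lemma mxevalU u m : ev 'X_[U_(u) + m] = M u *m ev 'X_[m].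
Proof. by rewrite !mxevalX mmap1D_comm // mmap1U. Qed.

Lemma mxeval0 : ev 'X_[0] = 1%:M.
Proof. by rewrite mxevalX mmap11. Qed.

Lemma hankel_mult u : H *m M u = S u.
Proof. by rewrite mulKVmx. Qed.

(** b_j(M) e_1 = e_j: when b_j = x_u b_j', column j' of S_u = H M_u and column
    j of H both consist of the values at the b'_i b_j, so M_u e_j' = e_j. *)
Lemma mxeval_col j : ev 'X_[b j] *m delta_mx j0 (0 : 'I_1) = delta_mx j 0.
Proof.
move: j; apply: (connected_family_ind cb) => [j bj|u j j' bj IH];
  apply: (can_inj (mulKmx unitH)).
  by rewrite bj mxeval0 mul1mx -!colE; apply/colP => i; rewrite !mxE bj bj0.
rewrite bj mxevalU -(mulmxA (M u)) IH (mulmxA H) hankel_mult -!colE.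
by apply/colP => i; rewrite !mxE bj.
Qed.

(** e_1^T H b'_i(M) = e_i^T H: when b'_i = x_u b'_i', row i' of S_u = H M_u is
    row i of H.  Here x_u(M) has to come last, next to S_u, which is possible
    because evaluation is multiplicative. *)
Lemma hankel_row i :
  delta_mx (0 : 'I_1) i0 *m H *m ev 'X_[b' i] = delta_mx 0 i *m H.
Proof.
move: i; apply: (connected_family_ind cb') => [i bi|u i i' bi IH].
  rewrite bi mxeval0 mulmx1 -!rowE; apply/rowP => j.
  by rewrite !mxE bi bi0.
rewrite bi addmC mpolyXD mxevalM // mulmxA IH -mulmxA.
rewrite mxevalX mmap1U hankel_mult -!rowE; apply/rowP => j.
by rewrite !mxE bi addmA [(U_(u) + _)%MM]addmC.
Qed.

Definition mult_form (p : {mpoly K[N]}) : K := (H *m ev p) i0 j0.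

Lemma mult_form_is_linear : scalar mult_form.
Proof.
move=> c p q; rewrite /mult_form linearP mulmxDr -scalemxAr.
by rewrite !mxE.
Qed.

HB.instance Definition _ :=
  GRing.isLinear.Build K {mpoly K[N]} K _ mult_form mult_form_is_linear.

Lemma mult_formE p q : mult_form (p * q) =
  ((delta_mx (0 : 'I_1) i0 *m H *m ev p) *m (ev q *m delta_mx j0 (0 : 'I_1))) 0 0.
Proof.
by rewrite /mult_form mxevalM // !mulmxA -colE -!mulmxA -rowE !mxE.
Qed.

Lemma mult_form_family i j p :
  mult_form ('X_[b' i] * (p * 'X_[b j])) = (H *m ev p) i j.
Proof.
rewrite mult_formE hankel_row mxevalM // -!mulmxA mxeval_col.
by rewrite !mulmxA -colE mxE -mulmxA -rowE mxE.
Qed.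

(** Pairing p with B' gives H p(M) e_1, and H is invertible.  Thus p is
    determined modulo the annihilator by p(M) e_1, its coordinates in B. *)
Lemma annih_col p :
  annih mult_form p <-> ev p *m delta_mx j0 (0 : 'I_1) = 0.
Proof.
split=> [Ip|p0 q]; last by rewrite mulrC /= mult_formE p0 mulmx0 mxE.
apply: (can_inj (mulKmx unitH)); rewrite mulmx0.
apply/colP => i; rewrite [RHS]mxE -(Ip 'X_[b' i]) mulrC /= mult_formE hankel_row.
by rewrite -mulmxA -rowE [RHS]mxE.
Qed.

(** Pairing p with B gives e_1^T H p(M), whose product by H^-1 is the row of
    coordinates of p in B'. *)
Lemma annih_row p :
  annih mult_form p <-> delta_mx (0 : 'I_1) i0 *m H *m ev p = 0.
Proof.
split=> [Ip|p0 q]; last by rewrite /= mult_formE p0 mul0mx mxE.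
apply/rowP => j; rewrite [RHS]mxE -(Ip 'X_[b j]) /= mult_formE mxeval_col.
by rewrite -colE [RHS]mxE.
Qed.

Lemma mult_form_basis : quotient_basis (annih mult_form) (fun j => 'X_[b j]).
Proof.
have sumE (c : 'I_r.+1 -> K) :
    ev (\sum_j c j *: 'X_[b j]) *m delta_mx j0 (0 : 'I_1) = \col_j c j.
  rewrite linear_sum mulmx_suml; apply/colP => i; rewrite summxE (bigD1 i) //=.
  rewrite big1 => [|j ij]; rewrite linearZ /= -scalemxAl mxeval_col !mxE.
    by rewrite !eqxx mulr1 addr0.
  by rewrite eq_sym (negbTE ij) mulr0.
split=> [c /annih_col|p].
  by rewrite sumE => /colP c0 j; have := c0 j; rewrite !mxE.
exists (fun j => (ev p *m delta_mx j0 (0 : 'I_1)) j 0); apply/annih_col.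
rewrite raddfB mulmxBl /= sumE; apply/eqP; rewrite subr_eq0; apply/eqP/colP => i.
by rewrite [RHS]mxE.
Qed.

Lemma mult_form_basis' : quotient_basis (annih mult_form) (fun i => 'X_[b' i]).
Proof.
have sumE (c : 'I_r.+1 -> K) :
    delta_mx (0 : 'I_1) i0 *m H *m ev (\sum_i c i *: 'X_[b' i])
    = (\row_i c i) *m H.
  rewrite [ev _]linear_sum mulmx_sumr [RHS]mulmx_sum_row; apply: eq_bigr => i _.
  by rewrite mxE linearZ -scalemxAr hankel_row -rowE.
split=> [c /annih_row|p].
  rewrite sumE => cH i.
  have /rowP/(_ i) : \row_i c i = 0.
    by apply: (can_inj (mulmxK unitH)); rewrite cH mul0mx.
  by rewrite !mxE.
exists (fun i => (delta_mx (0 : 'I_1) i0 *m H *m ev p *m invmx H) 0 i).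
apply/annih_row; rewrite raddfB mulmxBr /= sumE.
apply/eqP; rewrite subr_eq0; apply/eqP.
rewrite -[LHS](mulmxKV unitH); congr (_ *m _).
by apply/rowP => i; rewrite [RHS]mxE.
Qed.

Lemma mult_form_flat : flat_extension b' b L mult_form.
Proof.
split; [move=> i j /=|move=> u i j /=| |].
- have := mult_form_family i j 1; rewrite mul1r -mpolyXD => ->.
  by rewrite -mpolyX0 mxeval0 mulmx1 mxE.
- have := mult_form_family i j 'X_[U_(u)]; rewrite -!mpolyXD => ->.
  by rewrite mxevalX mmap1U hankel_mult mxE.
- exact: mult_form_basis.
- exact: mult_form_basis'.
Qed.

End Sufficiency.

Lemma flat_extension_exists (K : fieldType) N r (b' b : 'I_r -> 'X_{1..N})
    (L : 'X_{1..N} -> K) :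
  connected_family b -> connected_family b' ->
  hankel_mat b' b L \in unitmx ->
  (forall u v, mult_mat b' b L u *m mult_mat b' b L v =
               mult_mat b' b L v *m mult_mat b' b L u) ->
  exists Lt : {scalar {mpoly K[N]}}, flat_extension b' b L Lt.
Proof.
(* Without monomials the zero form is the extension; the construction above
   needs a position for the monomial 1. *)
case: r b b' => [|r] b b' cb cb' unitH comM.
  exists \0; split; try by [case|move=> ? []].
  - by split=> [c _ []//|p]; exists (fun=> 0) => q.
  - by split=> [c _ []//|p]; exists (fun=> 0) => q.
have [i0 bi0] := connected_family_unit cb' ord0.
have [j0 bj0] := connected_family_unit cb ord0.
by exists (mult_form b' b L i0 j0); apply: mult_form_flat.
Qed.

(** * Multigraded variables *)

Lemma mform_extensionP (K : fieldType) N (S : {pred 'X_{1..N}})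
    (f : 'X_{1..N} -> K) (Lt : {scalar {mpoly K[N]}}) :
  (forall w : subspace (mspan S), Lt (val w) = mform f w) <->
  (forall m, m \in S -> Lt 'X_[m] = f m).
Proof.
split=> [ext m mS|ext w].
  rewrite -[LHS]/(Lt (val (Subspace (mspanX K mS)))) ext /mform /=.
  by rewrite msuppX big_seq1 mcoeffX eqxx mul1r.
rewrite {1}(mpolyE (val w)) linear_sum /mform !big_seq; apply: eq_bigr => m m_w.
by rewrite linearZ /= ext //; move/mspan_supp: (valP w); apply.
Qed.

Section Multigraded.
Variables (K : fieldType) (k : nat) (n delta : 'I_k -> nat) (r : nat).

Local Notation N := (\sum_(l < k) n l)%N.

Lemma connected_to_1_family (B : r.-tuple 'X_{1..N}) :
  connected_to_1 B -> connected_family (tnth B).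
Proof.
move=> cB j; case: (cB _ (mem_tnth j B)) => [|[l [i [m [/tnthP[j' ->] ->]]]]].
  by left.
by right; exists (tagnat.Rank l i), j'.
Qed.

Variables (B' B : r.-tuple 'X_{1..N}).
Variable (Lambda : {scalar subspace (spanBBp_delta K delta B' B)}).
Variable (h : 'X_{1..N} -> K).

Local Notation Lh := (Lambda_h Lambda h).
Local Notation L := (Lambda_h_mon Lambda h).

Lemma Lambda_hX m (w : subspace (spanBBp K B' B)) : val w = 'X_[m] -> Lh w = L m.
Proof. by move=> wE; rewrite /= /mform wE msuppX big_seq1 mcoeffX eqxx mul1r. Qed.

Lemma hankel_mxE : hankel_mx Lh = hankel_mat (tnth B') (tnth B) L.
Proof. by apply/matrixP => i j; rewrite !mxE; apply: Lambda_hX. Qed.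

Lemma mult_mxE l (i : 'I_(n l)) :
  mult_mx Lh i = mult_mat (tnth B') (tnth B) L (tagnat.Rank l i).
Proof.
rewrite /mult_mx /mult_mat hankel_mxE; congr (_ *m _).
by apply/matrixP => a c; rewrite !mxE; apply: Lambda_hX.
Qed.

Lemma good_extensionP (Lt : {scalar {mpoly K[N]}}) :
  good_extension Lh Lt <-> flat_extension (tnth B') (tnth B) L Lt.
Proof.
split=> [[/mform_extensionP ext _ basisB basisB']|[LtH LtS basisB basisB']].
  split=> // [i j|u i j]; apply: ext.
    by apply: mprodBBp; apply: mem_tnth.
  by rewrite -(tagnat.sig2K u); apply: mprodBxB; apply: mem_tnth.
split=> //; last exact: has_rank_hankel basisB.
apply/mform_extensionP => _ /allpairsP[[m' m] /= [/tnthP[i ->] + ->]].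
rewrite mem_cat => /orP[/tnthP[j ->]|]; first exact: LtH.
by case/allpairsP => [[v m0] /= [_ /tnthP[j ->] ->]]; apply: LtS.
Qed.

End Multigraded.

Theorem theorem3p2 (K : closedFieldType) (charK : [pchar K] =i pred0)
  (k : nat) (n delta : 'I_k -> nat) (r : nat)
  (B B' : r.-tuple 'X_{1..(\sum_(l < k) n l)%N})
  (uniqB : uniq B) (uniqB' : uniq B')
  (BR : forall m, m \in B -> 'X_[m] \in Rdelta K delta)
  (B'R : forall m, m \in B' -> 'X_[m] \in Rdelta K delta)
  (B1 : connected_to_1 B) (B'1 : connected_to_1 B')
  (Lambda : {scalar subspace (spanBBp_delta K delta B' B)})
  (h : 'X_{1..(\sum_(l < k) n l)%N} -> K) :
  let Lh := Lambda_h Lambda h in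
  ((exists Lt : {scalar {mpoly K[(\sum_(l < k) n l)%N]}},
      good_extension Lh Lt) <->
   (\det (hankel_mx Lh) != 0 /\
    forall (l q : 'I_k) (i : 'I_(n l)) (j : 'I_(n q)),
      mult_mx Lh i *m mult_mx Lh j - mult_mx Lh j *m mult_mx Lh i = 0)) /\
  (forall Lt1 Lt2 : {scalar {mpoly K[(\sum_(l < k) n l)%N]}},
     good_extension Lh Lt1 -> good_extension Lh Lt2 -> Lt1 =1 Lt2).

Proof.
move=> Lh; have [cB cB'] := (connected_to_1_family B1, connected_to_1_family B'1).
split=> [|Lt1 Lt2 /good_extensionP flat1 /good_extensionP flat2]; last first.
  exact: flat_extension_unique flat1 flat2.
rewrite -unitfE hankel_mxE -unitmxE; split=> [[Lt /good_extensionP flat]|[unitH comM]].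
  split=> [|l q i j]; first exact: flat_hankel_unit flat.
  by rewrite !mult_mxE (flat_mult_comm flat) subrr.
have [|Lt /good_extensionP] := flat_extension_exists cB cB' unitH; last by exists Lt.
move=> u v; apply: subr0_eq; rewrite -(tagnat.sig2K u) -(tagnat.sig2K v).
by rewrite -!mult_mxE.
Qed.
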